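(* There is an explicit function $P_0(n,m)$ such that the following holds. Let $m,n,r$ be integers and $T\subseteq[m]\times[n]$, and suppose that every complex $T$-matrix has rank at least $r$. Let $\mathbb{F}$ be a field of characteristic zero or of finite characteristic $p>P_0(n,m)$. Then every $T$-matrix over $\mathbb{F}$ has rank at least $r$.
   Context: For $T\subseteq[m]\times[n]$, an $m\times n$ matrix $A$ over a field is a $T$-matrix if all entries of $A$ with indices in $T$ are non-zero and all entries with indices outside $T$ are zero. *)

(* Defs.v *)
From HB Require Import structures.
From mathcomp Require Import all_boot all_order all_algebra.
From mathcomp Require Import reals complex.

Set Implicit Arguments.
Unset Strict Implicit.
Unset Printing Implicit Defensive.

Import Order.TTheory GRing.Theory Num.Theory.

Local Open Scope ring_scope.

Definition T_matrix (F : fieldType) (m n : nat) (T : {set 'I_m * 'I_n})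
    (A : 'M[F]_(m, n)) : Prop :=
  (forall i j, (i, j) \in T -> A i j != 0) /\
  (forall i j, (i, j) \notin T -> A i j = 0).

Local Open Scope nat_scope.

Inductive primitive_recursive : forall k : nat, (k.-tuple nat -> nat) -> Prop :=
| PR_zero k : primitive_recursive (fun _ : k.-tuple nat => 0)
| PR_succ : primitive_recursive (fun v : 1.-tuple nat => (thead v).+1)
| PR_proj k (i : 'I_k) : primitive_recursive (fun v : k.-tuple nat => tnth v i)
| PR_comp k l (h : l.-tuple nat -> nat) (g : 'I_l -> k.-tuple nat -> nat) :
    primitive_recursive h -> (forall i, primitive_recursive (g i)) ->
    primitive_recursive (fun v : k.-tuple nat => h [tuple g i v | i < l])
| PR_rec k (f : k.-tuple nat -> nat) (g : k.+2.-tuple nat -> nat) :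
    primitive_recursive f -> primitive_recursive g ->
    primitive_recursive (fun v : k.+1.-tuple nat =>
      iteri (thead v) (fun i y => g [tuple of i :: y :: behead v])
        (f [tuple of behead v]))
| PR_ext k (f g : k.-tuple nat -> nat) :
    f =1 g -> primitive_recursive f -> primitive_recursive g.

(* An "explicit" function is read as one given by a primitive recursive scheme;
   mere existence of a function would also be witnessed by a non-effective
   maximum over the finitely many patterns T for each (n, m). *)
Definition explicit_function (P : nat -> nat -> nat) : Prop :=
  primitive_recursive (fun v : 2.-tuple nat => P (tnth v ord0) (tnth v ord_max)).

(* Main.v *)
(* Write the entries of A as a tuple x over F.  If p is large, x is replaced by
   a complex tuple y such that the same integer polynomials of bounded
   complexity vanish at x and at y; the T-pattern and the minors are among
   these polynomials, so the complex matrix is a T-matrix of the same rank.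
   Here "bounded complexity" means built from 0, 1, -1 and the variables by at
   most s levels of additions and multiplications, and x and y are compared in
   the product ring F * C.

   The tuple y is found one coordinate at a time.  Given y' matching x', the
   next coordinate y_k must be a common root of the univariate polynomials
   f_i(y', X) with f_i(x', x_k) = 0, and not a root of the product g(y', X) of
   the others.  If there is no such y_k, a power of g(y', X) lies in the ideal
   of the f_i(y', X), with cofactors of bounded degree.  This is a rank
   condition on matrices whose minors are bounded integer polynomials in y',
   so it also holds at x', which is absurd as g(x', x_k) <> 0.  For the empty
   tuple the polynomials are integers of absolute value at most 2 ^ (2 ^ s),
   whose vanishing is not affected by reduction modulo a larger prime. *)
Require Import Defs.
From HB Require Import structures.
From mathcomp Require Import all_boot all_order all_algebra.
From mathcomp Require Import reals complex.
From mathcomp Require Import perm zify.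

Set Implicit Arguments.
Unset Strict Implicit.
Unset Printing Implicit Defensive.

Import Order.TTheory GRing.Theory Num.Theory.

Local Open Scope ring_scope.

(** * Bounded integer expressions *)

(** An explicit list, so that it can be filtered and multiplied out, and so that it commutes with
    ring morphisms. As 0 is in every level, [u + 0] makes the levels increasing. *)
Fixpoint terms (S : comNzRingType) (z : seq S) (s : nat) : seq S :=
  if s is s'.+1 then
    [seq u + v | u <- terms z s', v <- terms z s'] ++
    [seq u * v | u <- terms z s', v <- terms z s']
  else [:: 0, 1, -1 & z].

Section Terms.
Variables (S : comNzRingType) (z : seq S).
Implicit Types (s : nat) (u v : S).

Lemma terms_add s u v :
  u \in terms z s -> v \in terms z s -> u + v \in terms z s.+1.
Proof. by move=> us vs; rewrite /= mem_cat allpairs_f. Qed.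

Lemma terms_mul s u v :
  u \in terms z s -> v \in terms z s -> u * v \in terms z s.+1.
Proof. by move=> us vs; rewrite /= mem_cat orbC allpairs_f. Qed.

Lemma terms0 s : 0 \in terms z s.
Proof.
by elim: s => [|s IHs]; [rewrite inE eqxx | rewrite -[0]addr0 terms_add].
Qed.

Lemma terms_le s t u : (s <= t)%N -> u \in terms z s -> u \in terms z t.
Proof.
move=> /subnKC <- us; elim: (t - s)%N => [|k IHk]; rewrite ?addn0 // addnS.
by rewrite -[u]addr0 terms_add ?terms0.
Qed.

Lemma terms1 s : 1 \in terms z s.
Proof. by apply: (@terms_le 0); rewrite // !inE eqxx orbT. Qed.

Lemma termsN1 s : -1 \in terms z s.
Proof. by apply: (@terms_le 0); rewrite // !inE eqxx !orbT. Qed.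

Lemma terms_sum (I : Type) (r : seq I) (F : I -> S) s :
  (forall i, F i \in terms z s) -> \sum_(i <- r) F i \in terms z (s + size r).
Proof.
move=> Fs; elim: r => [|i r IHr]; first by rewrite big_nil terms0.
by rewrite big_cons addnS terms_add // (terms_le _ (Fs i)) ?leq_addr.
Qed.

Lemma terms_prod (I : Type) (r : seq I) (F : I -> S) s :
  (forall i, F i \in terms z s) -> \prod_(i <- r) F i \in terms z (s + size r).
Proof.
move=> Fs; elim: r => [|i r IHr]; first by rewrite big_nil terms1.
by rewrite big_cons addnS terms_mul // (terms_le _ (Fs i)) ?leq_addr.
Qed.

(** Leibniz formula: [k] levels for the product of the entries, one for the sign, and one for each
    permutation, of which there are at most [k ^ k]. *)
Lemma terms_det k (A : 'M[S]_k) s :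
  (forall i j, A i j \in terms z s) -> \det A \in terms z (s + k + 1 + k ^ k).
Proof.
move=> As; rewrite /determinant.
apply: (@terms_le (s + k + 1 + #|{: {perm 'I_k}}|)).
  rewrite leq_add2l -[X in (_ <= X ^ _)%N]card_ord -[X in (_ <= _ ^ X)%N]card_ord.
  by rewrite -card_ffun (leq_card (@pval _)) //; apply: val_inj.
rewrite cardT -big_enum; apply: terms_sum => p.
rewrite addn1 terms_mul //.
  by case: (odd_perm p); rewrite ?expr1 ?expr0 (terms1, termsN1).
by rewrite -[X in (_ + X)%N](size_enum_ord k) -big_enum; apply: terms_prod.
Qed.

(** A level of size [N] is followed by one of size [2 * N ^ 2], so twice the size is squared at each
    step. *)
Lemma size_terms s : (2 * size (terms z s) = (2 * (size z + 3)) ^ (2 ^ s))%N.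
Proof.
elim: s => [|s IHs]; first by rewrite expn1 /= addn3.
rewrite expnSr expnM -IHs /= size_cat !size_allpairs -mulnn; lia.
Qed.

End Terms.

Lemma map_terms (S S' : comNzRingType) (f : {rmorphism S -> S'}) z s :
  map f (terms z s) = terms (map f z) s.
Proof.
elim: s => [|s IHs] /=; first by rewrite rmorph0 rmorphN rmorph1.
rewrite map_cat !map_allpairs -IHs !allpairs_mapl !allpairs_mapr.
by congr (_ ++ _); apply: eq_allpairs => u v; rewrite ?rmorphD ?rmorphM.
Qed.

(** * Pairs with the same vanishing expressions *)

(** With the converse below, this expresses the rank through the non-vanishing of minors, which are
    bounded expressions. *)
Lemma exists_unit_mxsub (F : fieldType) m n (A : 'M[F]_(m, n)) :
  exists (f : 'I_(\rank A) -> 'I_m) (g : 'I_(\rank A) -> 'I_n),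
    mxsub f g A \in unitmx.
Proof.
set B := rowsub (maxrankfun A) A.
have fullB : row_full B^T by rewrite /row_full mxrank_tr; exact: maxrowsub_free.
exists (maxrankfun A), (fullrankfun fullB).
rewrite -unitmx_tr; have := fullrowsub_unit fullB.
by congr (_ \in unitmx); apply/matrixP => i j; rewrite !mxE.
Qed.

Lemma unit_mxsub_leq_rank (F : fieldType) m n k (A : 'M[F]_(m, n))
    (f : 'I_k -> 'I_m) (g : 'I_k -> 'I_n) :
  mxsub f g A \in unitmx -> (k <= \rank A)%N.
Proof.
move/mxrank_unit => <-.
have -> : mxsub f g A = rowsub f 1%:M *m A *m colsub g 1%:M.
  by rewrite mul_rowsub_mx mul1mx mulmx_colsub mulmx1; apply/matrixP=> i j; rewrite !mxE.
by rewrite (leq_trans (mxrankM_maxl _ _)) ?mxrankM_maxr.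
Qed.

Section Agreement.
Variables K C : fieldType.
Implicit Type z : seq (K * C).

Definition agree z (s : nat) : Prop :=
  {in terms z s, forall w, (w.1 == 0) = (w.2 == 0)}.

Lemma agree_le z s t : (s <= t)%N -> agree z t -> agree z s.
Proof. by move=> le_st zt w ws; apply: zt; apply: terms_le ws. Qed.

(** Only minors of order at most [W] matter, because the column count bounds both ranks. The level
    is thus independent of the number of rows. *)
Lemma agree_rank z t W m n (A : 'M[K * C]_(m, n)) :
    (n <= W)%N -> (forall i j, A i j \in terms z t) ->
    agree z (t + W + 1 + W ^ W) ->
  \rank (map_mx fst A) = \rank (map_mx snd A).
Proof.
move=> leW At zW.
have minors k (f : 'I_k -> 'I_m) (g : 'I_k -> 'I_n) : (k <= W)%N ->
    (mxsub f g (map_mx fst A) \in unitmx) = (mxsub f g (map_mx snd A) \in unitmx).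
  move=> kW; rewrite -!map_mxsub !unitmxE !unitfE !det_map_mx zW //.
  apply: terms_le (terms_det (s := t) _) => [|i j]; last by rewrite mxE.
  rewrite leq_add ?leq_add2r ?leq_add2l //.
  (* The order 0 is treated apart: [0 ^ 0 = 1] must still be at most [W ^ W], also for [W = 0]. *)
  case: k kW {f g} => [|k] kW; first by rewrite expn_gt0; case: W {leW zW kW}.
  by rewrite (leq_trans (leq_pexp2l _ kW)) // leq_exp2r // (leq_ltn_trans _ kW).
have leWr (F : fieldType) (B : 'M[F]_(m, n)) : (\rank B <= W)%N.
  exact: leq_trans (rank_leq_col _) leW.
apply/eqP; rewrite eqn_leq; apply/andP; split.
  have [f [g]] := exists_unit_mxsub (map_mx fst A).
  by rewrite minors //; apply: unit_mxsub_leq_rank.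
have [f [g]] := exists_unit_mxsub (map_mx snd A).
by rewrite -minors //; apply: unit_mxsub_leq_rank.
Qed.

End Agreement.

(** * Polynomials of bounded degree with bounded coefficients *)

Section BoundedPoly.
Variables (S : comNzRingType) (z : seq S).
Implicit Types (t w : nat) (p q : {poly S}).

Definition bounded_poly t w p : Prop :=
  (size p <= w.+1)%N /\ (forall k, p`_k \in terms z t).

Lemma bounded_poly_le t t' w w' p :
  (t <= t')%N -> (w <= w')%N -> bounded_poly t w p -> bounded_poly t' w' p.
Proof.
move=> tt ww [sp cp]; split=> [|k]; last exact: terms_le (cp k).
exact: leq_trans sp _.
Qed.

Lemma bounded_polyD t w p q :
  bounded_poly t w p -> bounded_poly t w q -> bounded_poly t.+1 w (p + q).
Proof.
move=> [sp cp] [sq cq]; split=> [|k]; last by rewrite coefD terms_add.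
by rewrite (leq_trans (size_polyD _ _)) // geq_max sp.
Qed.

(** A coefficient of the product is a sum of at most [w1 + w2 + 1] products, each of level
    [t + 1]. *)
Lemma bounded_polyM t w1 w2 p q :
    bounded_poly t w1 p -> bounded_poly t w2 q ->
  bounded_poly (t + w1 + w2 + 2) (w1 + w2) (p * q).
Proof.
move=> [sp cp] [sq cq].
have spq : (size (p * q)%R <= (w1 + w2).+1)%N.
  by rewrite (leq_trans (size_polyMleq _ _)) //; lia.
split=> // k; have [gek|ltk] := leqP (w1 + w2).+1 k.
  by rewrite nth_default ?terms0 // (leq_trans spq).
rewrite coefM; apply: (@terms_le _ _ (t.+1 + k.+1)); first by lia.
rewrite -[X in (_ + X)%N](size_enum_ord k.+1) -big_enum.
by apply: terms_sum => i; rewrite terms_mul.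
Qed.

(** Here ['X] stands for the coordinate still to be found. Each level at most doubles the degree and
    costs at most [2 ^ s.+1 + 2] coefficient levels. *)
Lemma bounded_poly_terms s p : p \in terms ('X :: map polyC z) s ->
  bounded_poly (s * (2 ^ s + 2)) (2 ^ s) p.
Proof.
elim: s p => [|s IHs] p /=.
  rewrite !inE => /or4P[/eqP->|/eqP->|/eqP->|].
  - by split=> [|k]; rewrite ?size_poly0 // coef0 terms0.
  - by split=> [|k]; rewrite ?size_poly1 // coef1; case: eqP; rewrite ?terms0 ?terms1.
  - split=> [|k]; rewrite ?size_polyN ?size_poly1 // coefN coef1.
    by case: eqP; rewrite ?oppr0 ?terms0 ?termsN1.
  case/predU1P => [->|/mapP[c cz ->]].
    by split=> [|k]; rewrite ?size_polyX // coefX; case: eqP; rewrite ?terms0 ?terms1.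
  split=> [|k]; first by rewrite (leq_trans (size_polyC_leq1 _)).
  by rewrite coefC; case: eqP; rewrite ?terms0 // !inE cz !orbT.
rewrite mem_cat => /orP[] /allpairsP[[q r] /= [/IHs bq /IHs br ->]].
  apply: bounded_poly_le (bounded_polyD bq br); rewrite expnS; first by nia.
  by lia.
by apply: bounded_poly_le (bounded_polyM bq br); rewrite expnS; nia.
Qed.

Lemma bounded_poly_prod t w (r : seq {poly S}) :
    (forall p, p \in r -> bounded_poly t w p) ->
  bounded_poly (t + size r * (size r * w + 2)) (size r * w) (\prod_(p <- r) p).
Proof.
elim: r => [|p r IHr] br.
  rewrite big_nil; split=> [|k]; rewrite ?size_poly1 // coef1.
  by case: eqP; rewrite ?terms0 ?terms1.
have bp : bounded_poly t w p by apply: br; rewrite mem_head.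
have {IHr} := IHr (fun q qr => br q (mem_behead (s := p :: r) qr)).
rewrite big_cons /=; set l := size r => bq.
have {}bp : bounded_poly (t + l * (l * w + 2)) w p.
  by apply: bounded_poly_le bp; rewrite ?leq_addr.
by apply: bounded_poly_le (bounded_polyM bp bq); nia.
Qed.

End BoundedPoly.

(** * Univariate polynomials over a field *)

(** Roots of a non-zero [p] have multiplicity below [n], so if all were roots of [q], then [p] would
    divide [q ^+ n]. The induction strips a common linear factor from [p] and one factor [q] from
    the power. *)
Lemma exists_root_separating (C : closedFieldType) (p q : {poly C}) n :
  (0 < n)%N -> (size p <= n)%N -> ~~ (p %| q ^+ n) ->
  exists2 y, root p y & ~~ root q y.
Proof.
have [->|] := eqVneq p 0.
  move=> n0 _; rewrite dvd0p expf_eq0 n0 /= => /closed_nonrootP[y qy].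
  by exists y; rewrite ?root0.
move=> + _; elim: n p => [|n IHn] p p0 pn; first by rewrite -size_poly_gt0 ltnNge pn in p0.
have [|p1] := boolP (size p == 1)%N.
  by rewrite size_poly_eq1 => /eqp_dvdl ->; rewrite dvd1p.
have /closed_rootP[a pa] := p1.
have [qa|qa] := boolP (root q a); last by exists a.
move: (pa) (qa) => /factor_theorem[p' def_p] /factor_theorem[q' def_q].
have p'0 : p' != 0 by apply: contraNneq p0 => p'0; rewrite def_p p'0 mul0r.
move=> Ndvd; have [||y p'y qy] := IHn p' p'0.
- by move: pn; rewrite def_p size_Mmonic ?monicXsubC // size_XsubC addn2.
- by apply: contra Ndvd => ?; rewrite exprSr def_p {2}def_q mulrA mulrAC dvdp_mulr ?dvdp_mul.
by exists y; rewrite // def_p rootM p'y.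
Qed.


Lemma size_big_gcdp (F : fieldType) (fs : seq {poly F}) n :
  (forall f, f \in fs -> (size f <= n)%N) ->
  (size (\big[@gcdp F/0]_(f <- fs) f)%R <= n)%N.
Proof.
elim: fs => [|f fs IHfs] fsn; first by rewrite big_nil size_poly0.
rewrite big_cons; have [->|f0] := eqVneq f 0.
  by rewrite gcd0p IHfs // => g gfs; rewrite fsn // inE gfs orbT.
by rewrite (leq_trans (leq_gcdpl _ f0)) // fsn ?mem_head.
Qed.

Lemma root_big_gcdp (F : fieldType) (fs : seq {poly F}) y :
  root (\big[@gcdp F/0]_(f <- fs) f) y = all (fun f => root f y) fs.
Proof.
elim: fs => [|f fs IHfs]; first by rewrite big_nil root0.
by rewrite big_cons root_gcd IHfs.
Qed.

(* The cofactor of [gcdp f g] in front of [g] is reduced modulo [f]; this is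
   what keeps all degrees below [w]. *)
Lemma bezout_bounded (F : fieldType) (fs : seq {poly F}) d w (h : {poly F}) :
    (forall f, f \in fs -> (size f <= d.+1)%N) -> (2 * d < w)%N ->
    (size h <= w)%N -> \big[@gcdp F/0]_(f <- fs) f %| h ->
  exists a : nat -> {poly F},
    (forall i, (size (a i) <= w)%N) /\ h = \sum_(i < size fs) a i * fs`_i.
Proof.
move=> + dw; elim: fs h => [|f fs IHfs] h fsd hw.
  rewrite big_nil dvd0p => /eqP ->; exists (fun=> 0).
  by split=> [i|]; rewrite ?size_poly0 // big_ord0.
rewrite big_cons; set g := \big[_/_]_(i <- _) _ => gcd_h.
have fsd' f' : f' \in fs -> (size f' <= d.+1)%N.
  by move=> f'fs; rewrite fsd // inE f'fs orbT.
(* This is the case of two generators; the induction hypothesis then expands [v * g], whose size is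
   again at most [w]. *)
suff [u [v [uw vgw ->]]] : exists u v : {poly F},
    [/\ (size u <= w)%N, (size (v * g)%R <= w)%N & h = u * f + v * g].
  have [a [aw ->]] := IHfs _ fsd' vgw (dvdp_mull _ (dvdpp _)).
  exists (fun i => if i is i'.+1 then a i' else u).
  by split=> [[|i]|] //; rewrite big_ord_recl.
have [f0|f0] := eqVneq f 0.
  move: gcd_h; rewrite f0 gcd0p => /dvdpP[v def_h].
  by exists 0, v; rewrite size_poly0 -def_h mul0r add0r.
have [[u v] /= /eqp_dvdl guv] := Bezoutp f g.
have /dvdpP[c def_h] : u * f + v * g %| h by rewrite guv.
have vgw : (size ((c * v) %% f * g)%R <= w)%N.
  rewrite (leq_trans (size_polyMleq _ _)) //.
  have gd : (size g <= d.+1)%N by apply: size_big_gcdp.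
  have fd : (size f <= d.+1)%N by rewrite fsd ?mem_head.
  have := leq_trans (ltn_modpN0 (c * v) f0) fd.
  by move: (size _) (size g) gd => a b; lia.
pose v' := (c * v) %% f; pose u' := c * u + c * v %/ f * g.
have def_h' : h = u' * f + v' * g.
  rewrite def_h mulrDr !mulrA {1}(divp_eq (c * v) f) !mulrDl -!addrA.
  by congr (_ + (_ + _)); rewrite mulrAC.
exists u', v'; split=> //.
(* No separate reduction is needed for [u']: its size is bounded through [u' * f = h - v' * g], as
   [f] is non-zero. *)
have [->|u'0] := eqVneq u' 0; first by rewrite size_poly0.
have : (size (u' * f)%R <= w)%N.
  have -> : u' * f = h - v' * g by rewrite [in RHS]def_h' addrK.
  by rewrite (leq_trans (size_polyD _ _)) // size_polyN geq_max hw.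
rewrite size_mul //; move: f0; rewrite -size_poly_gt0.
by move: (size u') (size f) => a b; lia.
Qed.

(** * Linear combinations of polynomials as row spaces *)

Section CoefMatrix.
Variable W : nat.

Definition coef_mx (S : nzSemiRingType) m (r : 'I_m -> {poly S}) : 'M[S]_(m, W) :=
  \matrix_i poly_rV (r i).

Lemma map_poly_rV (S S' : nzSemiRingType) (f : {rmorphism S -> S'}) (p : {poly S}) :
  map_mx f (poly_rV p : 'rV_W) = poly_rV (map_poly f p).
Proof. by apply/rowP => k; rewrite !mxE coef_map. Qed.

Lemma map_coef_mx (S S' : nzSemiRingType) (f : {rmorphism S -> S'}) m
    (r : 'I_m -> {poly S}) :
  map_mx f (coef_mx r) = coef_mx (map_poly f \o r).
Proof. by apply/matrixP => i k; rewrite !mxE coef_map. Qed.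

Lemma sub_coef_mx (F : fieldType) m (r : 'I_m -> {poly F}) i :
  (poly_rV (r i) <= coef_mx r)%MS.
Proof. by rewrite -(rowK (fun i => poly_rV (r i)) i) row_sub. Qed.

Lemma root_coef_mx (F : fieldType) m (r : 'I_m -> {poly F}) (h : {poly F}) x :
    (forall i, (size (r i) <= W)%N) -> (size h <= W)%N ->
    (poly_rV h <= coef_mx r)%MS -> (forall i, root (r i) x) -> root h x.
Proof.
move=> rW hW /submxP[D def_h] rx.
rewrite -(poly_rV_K hW) def_h mulmx_sum_row linear_sum /root horner_sum big1 // => i _.
by rewrite linearZ /= hornerZ rowK poly_rV_K // (rootP (rx i)) mulr0.
Qed.

End CoefMatrix.

(** Lying in the span of the [r i] means that appending [h] as a row keeps the rank. By [agree_rank]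
    this passes from [C] to [K], where a combination of polynomials vanishing at [x] vanishes at
    [x]. *)
Lemma agree_root (K C : fieldType) (z : seq (K * C)) t W m
    (r : 'I_m -> {poly K * C}) (h : {poly K * C}) x :
    (forall i, (size (r i) <= W)%N) -> (size h <= W)%N ->
    (forall i k, (r i)`_k \in terms z t) -> (forall k, h`_k \in terms z t) ->
    agree z (t + W + 1 + W ^ W) ->
    (poly_rV (map_poly snd h) <= coef_mx W (map_poly snd \o r))%MS ->
    (forall i, root (map_poly fst (r i)) x) -> root (map_poly fst h) x.
Proof.
move=> rW hW rt ht zW hr rx.
pose A := col_mx (coef_mx W r) (poly_rV h).
have sub_eq (F : fieldType) (f : {rmorphism (K * C) -> F}) :
    (poly_rV (map_poly f h) <= coef_mx W (map_poly f \o r))%MS =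
    (\rank (coef_mx W (map_poly f \o r)) == \rank (map_mx f A)).
  have le_rA : (coef_mx W (map_poly f \o r) <= map_mx f A)%MS.
    by rewrite map_col_mx map_coef_mx -addsmxE addsmxSl.
  rewrite (mxrank_leqif_sup le_rA) map_col_mx map_coef_mx map_poly_rV.
  by rewrite col_mx_sub submx_refl.
apply: (@root_coef_mx W _ _ (map_poly fst \o r)) => // [i||].
- by rewrite /= (leq_trans (size_poly _ _)).
- by rewrite (leq_trans (size_poly _ _)).
move: hr; rewrite !sub_eq -!map_coef_mx.
rewrite (agree_rank (leqnn W) _ zW) => [|i j]; last by rewrite !mxE.
rewrite (agree_rank (leqnn W) _ zW) // => i j.
by rewrite mxE; case: split => k; rewrite !mxE.
Qed.

(** * Lifting one coordinate *)

(** Costs of one lifting step, with [d = 2 ^ s]: the number of expressions in at most [s + 1]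
    variables, the number of factors of [g ^+ d.+1], the level of its coefficients, the width of the
    coefficient matrices, and the level of their minors. *)
Definition term_count (s : nat) : nat := (2 * (s + 4)) ^ (2 ^ s).
Definition prod_length (s : nat) : nat := term_count s * (2 ^ s).+1.
Definition coef_level (s : nat) : nat :=
  s * (2 ^ s + 2) + prod_length s * (prod_length s * 2 ^ s + 2).
Definition mx_width (s : nat) : nat := prod_length s * 2 ^ s + 3 * 2 ^ s + 1.
Definition lift_level (s : nat) : nat :=
  coef_level s + mx_width s + 1 + mx_width s ^ mx_width s.

Lemma leq_lift_level s : (s <= lift_level s)%N.
Proof. by rewrite /lift_level /coef_level; nia. Qed.

Lemma size_terms_leq (S : comNzRingType) (z : seq S) s :
  (size z <= s.+1)%N -> (size (terms z s) <= term_count s)%N.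
Proof.
move=> zs; rewrite (leq_trans (leq_pmull _ (ltn0Sn 1))) // size_terms.
by rewrite leq_exp2r ?expn_gt0 //; lia.
Qed.

Section Lift.
Variables (K : fieldType) (C : closedFieldType).
Implicit Types (z : seq (K * C)) (x : K) (y : C).

(** Evaluation at [(x, y)] is a ring morphism, so by [map_terms] every expression in [(x, y) :: z]
    is the value of one in ['X] and constants. *)
Lemma agree_consP z x y s :
  (forall p, p \in terms ('X :: map polyC z) s ->
     root (map_poly fst p) x = root (map_poly snd p) y) ->
  agree ((x, y) :: z) s.
Proof.
move=> xy w.
have -> : (x, y) :: z = map (horner_eval (x, y)) ('X :: map polyC z).
  rewrite /= /horner_eval hornerX -map_comp; congr (_ :: _).
  by rewrite -[LHS]map_id; apply: eq_map => c /=; rewrite hornerC.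
rewrite -map_terms => /mapP[p ps ->]; rewrite /horner_eval.
have := xy p ps; rewrite /root.
have := horner_map (fst : {rmorphism (K * C) -> K}) p (x, y).
have := horner_map (snd : {rmorphism (K * C) -> C}) p (x, y).
by move=> /= -> ->.
Qed.

Lemma agree_lift z x s : (size z <= s)%N -> agree z (lift_level s) ->
  exists y, agree ((x, y) :: z) s.
Proof.
move=> zs zL.
pose P := terms ('X :: map polyC z) s; pose d := (2 ^ s)%N.
pose vanish (p : {poly K * C}) := root (map_poly fst p) x.
pose fs := filter vanish P; pose gs := filter (predC vanish) P.
pose fsC := map (map_poly snd) fs; pose g := \prod_(p <- gs) p.
have Pb p : p \in P -> bounded_poly z (s * (d + 2)) d p by apply: bounded_poly_terms.
have fsP p : p \in fs -> p \in P by rewrite mem_filter => /andP[].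
have gsP p : p \in gs -> p \in P by rewrite mem_filter => /andP[].
have snd_g : map_poly snd g = \prod_(p <- gs) map_poly snd p by apply: rmorph_prod.
have root_prod y : ~~ root (map_poly snd g) y ->
    forall p, p \in gs -> ~~ root (map_poly snd p) y.
  rewrite snd_g => gy p pgs; apply: contra gy.
  by rewrite (big_rem p pgs) /= rootM => ->.
pose G := \big[@gcdp C/0]_(f <- fsC) f.
have fsCd f : f \in fsC -> (size f <= d.+1)%N.
  case/mapP => p /fsP/Pb[pd _] ->; exact: leq_trans (size_poly _ _) pd.
have Gd : (size G <= d.+1)%N by apply: size_big_gcdp.
(* The exponent [d.+1] bounds the size of [G], as [exists_root_separating] requires. *)
have [dvdG|] := boolP (G %| map_poly snd g ^+ d.+1); last first.
  case/(exists_root_separating (ltn0Sn d) Gd) => y Gy gy; exists y.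
  apply: agree_consP => p pP; have [px|px] := boolP (root (map_poly fst p) x).
    rewrite root_big_gcdp in Gy; symmetry; apply: (allP Gy).
    by apply/mapP; exists p; rewrite // mem_filter [vanish _]px.
  by symmetry; apply/negbTE/(root_prod _ gy); rewrite mem_filter /= [vanish _](negbTE px).
(* Otherwise a power of [g] lies over [C], hence over [K], in the ideal
   generated by [fs], although it does not vanish at [x]. *)
pose gD := flatten (nseq d.+1 gs); set l := prod_length s.
have gDE : \prod_(p <- gD) p = g ^+ d.+1.
  by rewrite big_flatten big_nseq iter_mulr_1.
have gDl : (size gD <= l)%N.
  rewrite size_flatten /shape map_nseq sumn_nseq leq_mul2r orbC.
  rewrite size_filter (leq_trans (count_size _ _)) // size_terms_leq //=.
  by rewrite size_map.
(* The summand [l * d + 1] accommodates [g ^+ d.+1], and [2 * d < w] is the condition of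
   [bezout_bounded]. *)
pose w := (l * d + 2 * d + 1)%N.
have [sh ch] : bounded_poly z (coef_level s) (l * d) (g ^+ d.+1).
  rewrite -gDE; apply: bounded_poly_le (bounded_poly_prod (t := s * (d + 2)) (w := d) _).
  - by rewrite /coef_level leq_add2l leq_mul // leq_add2r leq_mul2r gDl orbT.
  - by rewrite leq_mul2r gDl orbT.
  by move=> p /flattenP[r /nseqP[-> _]] /gsP/Pb.
(* Multiplying by monomials turns combinations with cofactors of size at most [w] into linear
   combinations. *)
pose rl := [seq 'X^j * f | f <- fs, j <- iota 0 w].
have rlP q : q \in rl -> exists f j, [/\ f \in fs, (j < w)%N & q = 'X^j * f].
  case/allpairsP => [[f j] /= [ffs jw ->]]; exists f, j; split=> //.
  by rewrite mem_iota in jw.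
pose r (i : 'I_(size rl)) := rl`_i.
(* If [g ^+ d.+1] vanished at [x], so would some member of [gs], against the choice of [gs]. *)
suff: root (map_poly fst (g ^+ d.+1)) x.
  rewrite rmorphXn /= (root_exp (mulrC _ _)) // [map_poly fst g]rmorph_prod.
  rewrite /root horner_prod.
  rewrite prodf_seq_eq0.
  by case/hasP => p; rewrite mem_filter /= => /andP[/negP px _] /px.
apply: (@agree_root K C z (coef_level s) (mx_width s) _ r (g ^+ d.+1) x _ _ _ ch)
  => [i||i k|//||i].
- have [f [j [/fsP/Pb[fd _] jw def_r]]] := rlP _ (mem_nth 0 (ltn_ord i)).
  rewrite /r def_r (leq_trans (size_polyMleq _ _)) // size_polyXn.
  rewrite /mx_width -/l -/d; move: fd jw; rewrite /w.
  by move: (size _) => a; lia.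
- by rewrite (leq_trans sh) // /mx_width -/l -/d; lia.
- have [f [j [/fsP/Pb[_ fc] jw def_r]]] := rlP _ (mem_nth 0 (ltn_ord i)).
  rewrite /r def_r coefXnM; case: ifP => _; rewrite ?terms0 //.
  by apply: terms_le (fc _); rewrite leq_addr.
- have [||||a [aw def_g]] := @bezout_bounded C fsC d w (map_poly snd (g ^+ d.+1)).
  + by [].
  + by rewrite /w; lia.
  + rewrite (leq_trans (size_poly _ _)) // (leq_trans sh) // /w; lia.
  + by rewrite rmorphXn.
  rewrite def_g linear_sum summx_sub // => i _.
  rewrite -[a i]coefK poly_def mulr_suml linear_sum summx_sub // => j _.
  rewrite -scalerAl linearZ scalemx_sub //.
  have fi : (i < size fs)%N by rewrite -(size_map (map_poly snd)).
  have q_rl : 'X^j * fs`_i \in rl.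
    apply/allpairsP; exists (fs`_i, nat_of_ord j); split=> //=.
      exact: mem_nth.
    by rewrite mem_iota (leq_trans (ltn_ord j)).
  have q_lt : (index ('X^j * fs`_i)%R rl < size rl)%N by rewrite index_mem.
  have -> : 'X^j * fsC`_i = (map_poly snd \o r) (Ordinal q_lt).
    by rewrite /= /r nth_index // rmorphM /= map_polyXn (nth_map 0).
  exact: sub_coef_mx.
have [f [j [ffs _ def_r]]] := rlP _ (mem_nth 0 (ltn_ord i)).
rewrite /r def_r rmorphM rootM; apply/orP; right.
by move: ffs; rewrite mem_filter => /andP[].
Qed.

End Lift.

(** * Lifting a matrix *)

Lemma terms_nil_int (S : comNzRingType) s (w : S) : w \in terms [::] s ->
  exists2 k : int, (`|k| <= 2 ^ (2 ^ s))%N & w = k%:~R.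
Proof.
elim: s w => [|s IHs] w /=.
  by rewrite !inE => /or3P[] /eqP ->; [exists 0 | exists 1 | exists (-1)].
rewrite mem_cat expnSr expnM -mulnn.
(* Since [b] is at least 2, [b + b <= b * b], so sums obey the bound for products. *)
have : (2 <= 2 ^ 2 ^ s)%N by rewrite -{1}[2%N]expn1 leq_exp2l // expn_gt0.
move: (2 ^ 2 ^ s)%N IHs => b IHs b2.
case/orP=> /allpairsP[[u v] /= [/IHs[k kb ->] /IHs[l lb ->] ->]].
  by exists (k + l); rewrite ?rmorphD //; nia.
by exists (k * l); rewrite ?rmorphM // abszM leq_mul.
Qed.

Lemma intr_eq0_small (K : fieldType) b (k : int) :
    [pchar K] =i pred0 \/ (exists2 p, p \in [pchar K] & (b < p)%N) ->
    (`|k| <= b)%N -> (k%:~R == 0 :> K) = (k == 0).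
Proof.
move=> charK kb; apply/idP/idP => [|/eqP-> //].
rewrite {1}(intEsign k) rmorphM rmorph_sign mulf_eq0 signr_eq0 /= -absz_eq0.
case: charK => [char0|[p charp bp]]; first by move/pcharf0P: char0 => ->.
rewrite -[_%:~R]/(`|k|%:R) -(dvdn_pcharf charp) => pk.
by apply: contraLR pk; rewrite -lt0n => k0; rewrite gtnNdvd // (leq_ltn_trans kb).
Qed.

Lemma agree_nil (K : fieldType) (C : numClosedFieldType) s :
    [pchar K] =i pred0 \/ (exists2 p, p \in [pchar K] & (2 ^ (2 ^ s) < p)%N) ->
  agree ([::] : seq (K * C)) s.
Proof.
move=> charK _ /terms_nil_int[k kb ->].
have := rmorph_int (fst : {rmorphism (K * C) -> K}) k.
have := rmorph_int (snd : {rmorphism (K * C) -> C}) k.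
by move=> /= -> ->; rewrite (intr_eq0_small charK kb) intr_eq0.
Qed.

(** The head is lifted last, so the tail has to agree at level [lift_level s]; each coordinate costs
    one iteration. *)
Lemma agree_lift_seq (K : fieldType) (C : closedFieldType) (xs : seq K) s :
    (size xs <= s)%N ->
    agree ([::] : seq (K * C)) (iter (size xs) lift_level s) ->
  exists2 z : seq (K * C), map fst z = xs & agree z s.
Proof.
elim: xs s => [|x xs IHxs] s xss; first by exists [::].
rewrite [size _]/= iterSr => /IHxs[|z def_xs zs].
  by rewrite (leq_trans (ltnW xss)) ?leq_lift_level.
have [|y yzs] := agree_lift x _ zs.
  by rewrite -(size_map fst) def_xs ltnW.
by exists ((x, y) :: z); rewrite //= def_xs.
Qed.

(** The summand [m * n] meets the length condition of [agree_lift_seq]; the rest is the level of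
    [agree_rank] for entries of level 0 and [n] columns. *)
Definition start_level (n m : nat) : nat := m * n + n + 1 + n ^ n.

Definition char_bound (n m : nat) : nat :=
  2 ^ (2 ^ (iter (m * n) lift_level (start_level n m))).

Lemma T_matrix_lift (K : fieldType) (C : numClosedFieldType) m n
    (T : {set 'I_m * 'I_n}) (A : 'M[K]_(m, n)) :
    [pchar K] =i pred0 \/
      (exists2 p, p \in [pchar K] & (char_bound n m < p)%N) ->
    T_matrix T A ->
  exists2 B : 'M[C]_(m, n), T_matrix T B & \rank B = \rank A.
Proof.
move=> charK [AT AnT].
pose e := enum {: 'I_m * 'I_n}.
pose xs := [seq A ij.1 ij.2 | ij <- e].
have size_xs : size xs = (m * n)%N by rewrite size_map -cardE card_prod !card_ord.
have [||z def_xs zs] := @agree_lift_seq K C xs (start_level n m).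
- by rewrite size_xs /start_level -!addnA leq_addr.
- by rewrite size_xs; apply: agree_nil.
have size_z : size z = size e by rewrite -(size_map fst) def_xs size_map.
pose Z : 'M[K * C]_(m, n) := \matrix_(i, j) z`_(index (i, j) e).
have ij_e i j : (index (i, j) e < size e)%N by rewrite index_mem mem_enum.
have Zz i j : Z i j \in terms z 0.
  by rewrite mxE !inE mem_nth ?size_z ?orbT.
have fstZ : map_mx fst Z = A.
  apply/matrixP => i j; rewrite !mxE -(nth_map _ 0) ?size_z // def_xs.
  by rewrite (nth_map (i, j)) // nth_index ?mem_enum.
have Z0 i j : (map_mx snd Z i j == 0) = (A i j == 0).
  rewrite -fstZ mxE [in RHS]mxE; symmetry; apply: zs.
  exact: terms_le (Zz i j).
exists (map_mx snd Z).
  split=> i j ijT; first by rewrite Z0 AT.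
  by apply/eqP; rewrite Z0 AnT.
rewrite -fstZ; symmetry; apply: (agree_rank (leqnn n) Zz).
by apply: agree_le zs; rewrite /start_level add0n -!addnA leq_addl.
Qed.

(** * Primitive recursive bounds *)

Section PrimitiveRecursive.
Local Open Scope nat_scope.
Implicit Types (k : nat) (f : nat -> nat) (h : nat -> nat -> nat).

Definition unary_pr f : Prop := primitive_recursive (fun v : 1.-tuple nat => f (thead v)).

Lemma pr_comp1 k f (u : k.-tuple nat -> nat) :
  unary_pr f -> primitive_recursive u -> primitive_recursive (fun v => f (u v)).
Proof.
move=> prf pru; apply: PR_ext (PR_comp (g := fun=> u) prf (fun=> pru)) => v.
by rewrite /thead tnth_mktuple.
Qed.

Lemma pr_comp2 k h (u w : k.-tuple nat -> nat) :
    explicit_function h -> primitive_recursive u -> primitive_recursive w ->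
  primitive_recursive (fun v => h (u v) (w v)).
Proof.
move=> prh pru prw; pose g (i : 'I_2) := if i == ord0 then u else w.
have prg i : primitive_recursive (g i) by rewrite /g; case: ifP.
by apply: PR_ext (PR_comp prh prg) => v; rewrite !tnth_mktuple.
Qed.

Lemma pr_const k c : primitive_recursive (fun _ : k.-tuple nat => c).
Proof.
by elim: c => [|c IHc]; [exact: PR_zero | exact: pr_comp1 PR_succ IHc].
Qed.

(** Source of addition, multiplication, powers and the iterated [lift_level]. *)
Lemma pr_iter f h : unary_pr f -> explicit_function h ->
  explicit_function (fun a b => iter a (h b) (f b)).
Proof.
move=> prf prh.
(* The recursion step receives the counter, the current value and [b], in this order; the counter is
   dropped. *)
have prg : primitive_recursive
    (fun v : 3.-tuple nat => h (tnth v ord_max) (tnth v (inord 1))).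
  by apply: pr_comp2; rewrite //; apply: PR_proj.
apply: PR_ext (PR_rec prf prg) => v.
case/tupleP: v => a v; case/tupleP: v => b v; rewrite tuple0 /=.
rewrite /thead !(tnth_nth 0) /=.
rewrite (@eq_iteri _ _ (fun _ => h b)) => [|i y]; first by elim: a => //= a ->.
by rewrite !(tnth_nth 0) /= inordK.
Qed.

Lemma unary_pr_id : unary_pr id.
Proof. by apply: PR_proj. Qed.

Lemma prD k (u w : k.-tuple nat -> nat) : primitive_recursive u ->
  primitive_recursive w -> primitive_recursive (fun v => u v + w v).
Proof.
apply: (@pr_comp2 _ addn).
have prS : explicit_function (fun _ y => y.+1).
  by apply: pr_comp1 PR_succ _; apply: PR_proj.
apply: PR_ext (pr_iter unary_pr_id prS) => v.
by rewrite iter_succn addnC.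
Qed.

Lemma prM k (u w : k.-tuple nat -> nat) : primitive_recursive u ->
  primitive_recursive w -> primitive_recursive (fun v => u v * w v).
Proof.
apply: (@pr_comp2 _ muln).
have pr_add : explicit_function addn by apply: prD; apply: PR_proj.
apply: PR_ext (pr_iter (f := fun=> 0) (pr_const 1 0) pr_add) => v.
by rewrite iter_addn_0 mulnC.
Qed.

Lemma prX k (u w : k.-tuple nat -> nat) : primitive_recursive u ->
  primitive_recursive w -> primitive_recursive (fun v => u v ^ w v).
Proof.
move=> pru prw; apply: (@pr_comp2 _ (fun b a => a ^ b)) => //.
have pr_mul : explicit_function muln by apply: prM; apply: PR_proj.
apply: PR_ext (pr_iter (f := fun=> 1) (pr_const 1 1) pr_mul) => v.
by rewrite iter_muln_1.
Qed.

Lemma unary_pr_lift_level : unary_pr lift_level.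
Proof.
have pr_s : primitive_recursive (fun v : 1.-tuple nat => thead v) by apply: PR_proj.
have pr_2s : unary_pr (fun s => 2 ^ s) by apply: prX; [apply: pr_const | apply: pr_s].
have pr_count : unary_pr term_count.
  by do ![done | apply: prX | apply: prM | apply: prD | apply: pr_const | exact: pr_s].
have pr_length : unary_pr prod_length.
  by apply: prM => //; apply: pr_comp1 PR_succ _.
have pr_width : unary_pr mx_width.
  by do ![done | apply: prM | apply: prD | apply: pr_const | exact: pr_s].
have pr_coef : unary_pr coef_level.
  by do ![done | apply: prM | apply: prD | apply: pr_const | exact: pr_s].
by apply: prD; [do ![done | apply: prD | apply: pr_const | exact: pr_s] | apply: prX].
Qed.

Lemma explicit_char_bound : explicit_function char_bound.
Proof.
have pr_n : explicit_function (fun n _ => n) by apply: PR_proj.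
have pr_m : explicit_function (fun _ m => m) by apply: PR_proj.
have pr_lift : explicit_function (fun a b => iter a lift_level b).
  apply: (pr_iter unary_pr_id); apply: pr_comp1 unary_pr_lift_level _.
  exact: PR_proj.
have pr_start : explicit_function start_level.
  by do ![done | apply: prD | apply: prM | apply: prX | apply: pr_const].
do 2![apply: prX; first exact: pr_const].
by apply: (pr_comp2 pr_lift) => //; apply: prM.
Qed.

End PrimitiveRecursive.

Theorem theorem8p3 :
  exists2 P0 : nat -> nat -> nat, explicit_function P0 &
    forall (R : realType) (m n : nat) (r : int) (T : {set 'I_m * 'I_n}),
      (forall A : 'M[R[i]]_(m, n), T_matrix T A -> r <= (\rank A)%:Z) ->
      forall F : fieldType,
        [pchar F] =i pred0 \/
        (exists2 p : nat, p \in [pchar F] & (P0 n m < p)%N) ->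
        forall A : 'M[F]_(m, n), T_matrix T A -> r <= (\rank A)%:Z.
Proof.
exists char_bound; first exact: explicit_char_bound.
move=> R m n r T rank_ge F charF A TA.
by have [B /rank_ge] := T_matrix_lift R[i] charF TA; move=> + <-.
Qed.
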